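(* Let $F:\mathbb{R}^+\to\mathbb{R}$ be a function, and let $(L(t),M(t))$ be the solution of the generalized finite relativistic Toda lattice $$\dot L=\bigl(F(LM^{-1})\bigr)_-L-L\bigl(F(M^{-1}L)\bigr)_-,\qquad \dot M=\bigl(F(LM^{-1})\bigr)_-M-M\bigl(F(M^{-1}L)\bigr)_-$$ with positive initial data $a_n(0)>0$, $b_n(0)>0$. Then the spectral data $w_j$ of $(L(t),M(t))$ have the time evolution $$w_j(t)=\frac{w_j(0)\,e^{-tF(\lambda_j)}}{\sum_{k=1}^N w_k(0)\,e^{-tF(\lambda_k)}},\qquad 1\le j\le N.$$
   Context: $\mathbb{R}^+=(0,\infty)$. For matrix data $a_1,\ldots,a_N>0$ and $b_1,\ldots,b_{N-1}>0$ (functions of $t$), $L$ is the $N\times N$ upper bidiagonal matrix with $L_{n,n}=a_n$, $L_{n,n+1}=1$, all other entries $0$; $M$ is the $N\times N$ lower bidiagonal matrix with $M_{n,n}=1$, $M_{n+1,n}=-b_n$, all other entries $0$. Solutions are taken with $a_n(t)>0$, $b_n(t)>0$. For a square matrix $X$, $X_-$ denotes its strictly lower triangular part. The generalized eigenvalue problem $L\vec x=\lambda M\vec x$ has $N$ distinct positive eigenvalues $0<\lambda_1<\cdots<\lambda_N$ (the zeros of $\det(zM-L)$), which are also the eigenvalues of the diagonalizable matrices $LM^{-1}$ and $M^{-1}L$; along solutions of the system they do not depend on $t$. For a diagonalizable matrix $X=S\,\mathrm{diag}(\lambda_1,\ldots,\lambda_N)S^{-1}$ with positive eigenvalues, $F(X)=S\,\mathrm{diag}(F(\lambda_1),\ldots,F(\lambda_N))S^{-1}$.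 For each $j$ let $\vec v_j$ and $\vec u_j$ be the right and left eigenvectors, $L\vec v_j=\lambda_jM\vec v_j$ and $\vec u_j^{\,T}L=\lambda_j\vec u_j^{\,T}M$, both normalized to have first component $1$ (always possible); then $\vec u_j^{\,T}M\vec v_j\neq0$ and $w_j=(\vec u_j^{\,T}M\vec v_j)^{-1}$. $w_j(t)$ denotes $w_j$ for the pair $(L(t),M(t))$. *)

(* Defs.v *)
From HB Require Import structures.
From mathcomp Require Import all_boot all_order all_algebra.
From mathcomp Require Import polyrcf.
From mathcomp Require Import all_classical all_reals all_analysis.

Set Implicit Arguments.
Unset Strict Implicit.
Unset Printing Implicit Defensive.

Import Order.TTheory GRing.Theory Num.Theory.
Import numFieldNormedType.Exports.

Local Open Scope classical_set_scope.
Local Open Scope ring_scope.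

(* The matrix size is n.+1 and indices start at 0: the diagonal parameters are
   a 0, ..., a n and the off-diagonal ones b 0, ..., b n.-1.  For k < n the
   positions (k, k.+1) and (k.+1, k) are written with
   [widen_ord (leqnSn n) k], of value k, and [lift ord0 k], of value k.+1. *)
Definition Lmx (R : realType) (n : nat) (a : 'I_n.+1 -> R) : 'M[R]_n.+1 :=
  diag_mx (\row_i a i)
  + \sum_(k < n) delta_mx (widen_ord (leqnSn n) k) (lift ord0 k).

Definition Mmx (R : realType) (n : nat) (b : 'I_n -> R) : 'M[R]_n.+1 :=
  1%:M - \sum_(k < n) b k *: delta_mx (lift ord0 k) (widen_ord (leqnSn n) k).

Definition strict_lower (R : realType) (n : nat) (X : 'M[R]_n) : 'M[R]_n :=
  \matrix_(i, j) (if (j < i)%N then X i j else 0).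

(* Only the values of F on positive reals matter.  The result does not depend
   on the chosen diagonalization of X; it is 0 if X is not diagonalizable with
   positive eigenvalues. *)
Definition mxfun (R : realType) (n : nat) (F : R -> R) (X : 'M[R]_n) : 'M[R]_n :=
  xget 0 [set Y | exists (S : 'M[R]_n) (d : 'rV[R]_n),
    [/\ S \in unitmx,
        forall i, 0 < d ord0 i,
        X = S *m diag_mx d *m invmx S &
        Y = S *m diag_mx (map_mx F d) *m invmx S]].

Definition pencil_poly (R : realType) (n : nat) (L M : 'M[R]_n) : {poly R} :=
  \det ('X *: map_mx polyC M - map_mx polyC L).

(* [rootsR p] lists the distinct real roots of p in increasing order. *)
Definition pencil_eig (R : realType) (n : nat) (L M : 'M[R]_n) (j : 'I_n) : R :=
  (rootsR (pencil_poly L M))`_j.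

Definition right_eigvec (R : realType) (n : nat) (L M : 'M[R]_n.+1) (z : R) :
    'cV[R]_n.+1 :=
  xget 0 [set v | L *m v = z *: (M *m v) /\ v ord0 ord0 = 1].

Definition left_eigvec (R : realType) (n : nat) (L M : 'M[R]_n.+1) (z : R) :
    'cV[R]_n.+1 :=
  xget 0 [set u | u^T *m L = z *: (u^T *m M) /\ u ord0 ord0 = 1].

Definition spectral_weight (R : realType) (n : nat) (L M : 'M[R]_n.+1)
    (j : 'I_n.+1) : R :=
  let z := pencil_eig L M j in
  (((left_eigvec L M z)^T *m M *m right_eigvec L M z) ord0 ord0)^-1.

(* J is the time interval.  It may contain its end points (e.g. J = [0, T[);
   there only continuity is required, the equations being imposed in the
   interior of J. *)
Definition toda_solution (R : realType) (n : nat) (F : R -> R) (J : set R)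
    (a : R -> 'I_n.+1 -> R) (b : R -> 'I_n -> R) : Prop :=
  let L t := Lmx (a t) in
  let M t := Mmx (b t) in
  let A t := strict_lower (mxfun F (L t *m invmx (M t))) in
  let B t := strict_lower (mxfun F (invmx (M t) *m L t)) in
  [/\ forall t, J t -> (forall i, 0 < a t i) /\ (forall k, 0 < b t k),
      {within J, continuous L},
      {within J, continuous M},
      forall t, interior J t ->
        is_derive t 1 L (A t *m L t - L t *m B t) &
      forall t, interior J t ->
        is_derive t 1 M (A t *m M t - M t *m B t)].

(* Main.v *)
Require Import Defs.
From mathcomp Require Import all_boot all_order all_algebra.
From mathcomp Require Import polyrcf.
From mathcomp Require Import all_classical all_reals all_analysis.
From mathcomp Require Import ring lra zify.

Set Implicit Arguments.
Unset Strict Implicit.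
Unset Printing Implicit Defensive.

Import Order.TTheory GRing.Theory Num.Theory.
Import numFieldNormedType.Exports.

Local Open Scope classical_set_scope.
Local Open Scope ring_scope.

(* Let G = z M - L. Its first n rows determine a column vector v(z) with first
   entry 1, given by a three-term recurrence, and G v = p(z) e_n where the roots
   of p are the generalized eigenvalues. They are positive and distinct because
   the polynomials of the recurrence have interlacing roots. Along the flow
   G' = A G - G B with A, B strictly lower triangular, and differentiating
   G v = p e_n yields v' = B v and p' = 0: the eigenvalues are constant. For the
   left eigenvectors u at an eigenvalue z, u G = 0 yields u' = c u - u A with
   c = (u A)_0 = F(z) - F(L M^-1)_00. Hence d = u M v satisfies d' = c d, so that
   d_j / d_k exp (t (F(z_k) - F(z_j))) is constant. The weights w_j = 1 / d_j
   have sum (M^-1)_00 = 1, which fixes the normalization. *)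

(** * Polynomials of the three-term recurrence and their roots *)

(** This is the leading principal minor of order [k] of z M - L, expanded along its last row; the
    product of the two off-diagonal entries gives the term with [b]. *)
Fixpoint orth_poly (R : comNzRingType) (a b : nat -> R) (k : nat) : {poly R} :=
  if k is k'.+1 then
    ('X - (a k')%:P) * orth_poly a b k'
    - (if k' is k''.+1 then b k'' *: ('X * orth_poly a b k'') else 0)
  else 1.

Lemma horner_orth_polyS (R : comNzRingType) (a b : nat -> R) k z :
  (orth_poly a b k.+1).[z] = (z - a k) * (orth_poly a b k).[z]
  - (if k is k'.+1 then z * b k' * (orth_poly a b k').[z] else 0).
Proof.
rewrite hornerD hornerN hornerM hornerXsubC; congr (_ - _).
by case: k => [|k]; rewrite ?horner0 // hornerZ hornerM hornerX mulrCA mulrA.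
Qed.

Lemma monic_orth_poly (R : idomainType) (a b : nat -> R) k :
  orth_poly a b k \is monic /\ size (orth_poly a b k) = k.+1.
Proof.
have [k1] := ubnP k; elim: k1 k => // k1 IH [|k] hk.
  by rewrite /= monic1 size_poly1.
have [mk sk] := IH k hk.
have sz : size (('X - (a k)%:P) * orth_poly a b k) = k.+2.
  by rewrite size_monicM ?monicXsubC ?monic_neq0 // size_XsubC sk.
have m : ('X - (a k)%:P) * orth_poly a b k \is monic.
  by rewrite monicMl ?monicXsubC.
pose q := if k is k''.+1 then b k'' *: ('X * orth_poly a b k'') else 0.
have sq : (size q < k.+2)%N.
  rewrite /q; case: (k) IH hk => [|k''] IH hk; first by rewrite size_poly0.
  apply: leq_ltn_trans (size_scale_leq _ _) _.
  have [m2 s2] := IH k'' (ltnW hk).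
  by rewrite size_monicM ?monicX ?monic_neq0 // size_polyX s2.
have -> : orth_poly a b k.+1 = ('X - (a k)%:P) * orth_poly a b k + - q by [].
split; last by rewrite size_polyDl ?size_polyN ?sz.
by rewrite monicE lead_coefDl ?size_polyN ?sz // -monicE.
Qed.

Lemma sign_prod_sub (R : realDomainType) (s : nat -> R) (x : R) k i :
  (i <= k)%N -> (forall j, (j < i)%N -> s j < x) ->
  (forall j, (i <= j < k)%N -> x < s j) ->
  0 < (-1) ^+ (k - i) * \prod_(0 <= j < k) (x - s j).
Proof.
move=> ik lo hi; rewrite (big_cat_nat _ ik) //= mulrCA; apply: mulr_gt0.
  by rewrite big_mkord prodr_gt0 // => j _; rewrite subr_gt0 lo.
rewrite -prodr_const_nat -big_split /= big_nat_cond.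
by apply: prodr_gt0 => j /andP[/hi]; lra.
Qed.

(** The sign changes give a root in each of the [m] gaps between consecutive points. These roots are
    distinct, being separated by the points, and their number is the degree, so [p] splits. *)
Lemma alternating_roots (R : rcfType) (p : {poly R}) (x : nat -> R) m :
  p \is monic -> size p = m.+1 ->
  (forall i, (i < m)%N -> x i < x i.+1) ->
  (forall i, (i <= m)%N -> 0 < (-1) ^+ (m - i) * p.[x i]) ->
  exists r : nat -> R, [/\ p = \prod_(0 <= j < m) ('X - (r j)%:P),
    forall i j, (i <= j < m)%N -> x i < r j &
    forall i j, (j < i <= m)%N -> r j < x i].
Proof.
move=> mp sp incx sgn.
have lex i j : (i <= j <= m)%N -> x i <= x j.
  elim: j => [|j IH]; first by case: i.
  case/andP; rewrite leq_eqVlt => /orP[/eqP-> //|ij] jm.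
  by apply: le_trans (ltW (incx j jm)); apply: IH; lia.
(* The implication makes the claim total in [i], so that [xchoose] yields a sequence; the witness 0
   covers the indices from [m] on. *)
have ex i : exists y, (i < m)%N ==> (x i < y < x i.+1) && root p y.
  case: (ltnP i m) => im; last by exists 0.
  have [|y] := @poly_ivtoo _ p (x i) (x i.+1) (ltW (incx i im)).
    have := mulr_gt0 (sgn i (ltnW im)) (sgn i.+1 im).
    rewrite (_ : m - i = (m - i.+1).+1)%N; last lia.
    rewrite exprS; set e := (-1) ^+ _.
    have : e ^+ 2 = 1 by rewrite /e sqrr_sign.
    by nra.
  by rewrite in_itv /= => yi yr; exists y; rewrite yi.
pose r i := xchoose (ex i).
have rP i : (i < m)%N -> x i < r i < x i.+1 /\ root p (r i).
  by move=> im; apply/andP; apply: implyP (xchooseP (ex i)) im.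
have lo i j : (i <= j < m)%N -> x i < r j.
  move=> ij; have [|/andP[h _] _] := rP j; first lia.
  by apply: le_lt_trans h; apply: lex; lia.
have hi i j : (j < i <= m)%N -> r j < x i.
  move=> ij; have [|/andP[_ h] _] := rP j; first lia.
  by apply: lt_le_trans h _; apply: lex; lia.
exists r; split => //.
have -> : p = lead_coef p *: \prod_(z <- map r (index_iota 0 m)) ('X - z%:P).
  apply: all_roots_prod_XsubC.
  - by rewrite sp size_map size_iota subn0.
  - by apply/allP => z /mapP[i]; rewrite mem_index_iota => /= im ->; case: (rP i im).
  - rewrite uniq_rootsE map_inj_in_uniq ?iota_uniq // => i j.
    rewrite !mem_index_iota /= => im jm rij; apply/eqP.
    rewrite eqn_leq; apply/andP; split; rewrite leqNgt; apply/negP => ij.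
      have h1 : r j < x j.+1 by apply: hi; lia.
      have h2 : x j.+1 < r i by apply: lo; lia.
      by have := lt_trans h1 h2; rewrite rij ltxx.
    have h1 : r i < x i.+1 by apply: hi; lia.
    have h2 : x i.+1 < r j by apply: lo; lia.
    by have := lt_trans h1 h2; rewrite rij ltxx.
by rewrite (monicP mp) scale1r big_map.
Qed.

(** The factor z of the [b] term kills it at 0. This sign at 0 is what forces the smallest root to
    be positive in the interlacing argument. *)
Lemma sign_orth_poly0 (R : realDomainType) (a b : nat -> R) k :
  (forall k, 0 < a k) -> 0 < (-1) ^+ k * (orth_poly a b k).[0].
Proof.
move=> a0; elim: k => [|k IH]; first by rewrite expr0 mul1r hornerC ltr01.
suff -> : (orth_poly a b k.+1).[0] = - (a k * (orth_poly a b k).[0]).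
  by rewrite exprS mulN1r mulrNN mulrCA mulr_gt0.
by rewrite horner_orth_polyS; case: k {IH} => [|k]; ring.
Qed.

(* The recurrence gives the sign of [orth_poly a b k.+2] at the roots of
   [orth_poly a b k.+1], as opposite to that of [orth_poly a b k]. *)
Lemma orth_poly_interlacing (R : rcfType) (a b : nat -> R) k :
  (forall k, 0 < a k) -> (forall k, 0 < b k) ->
  exists s r : nat -> R,
  [/\ orth_poly a b k = \prod_(0 <= j < k) ('X - (s j)%:P),
      orth_poly a b k.+1 = \prod_(0 <= j < k.+1) ('X - (r j)%:P),
      forall i j, (i <= j < k)%N -> r i < s j,
      forall i j, (j < i <= k)%N -> s j < r i & 0 < r 0%N].
Proof.
move=> a0 b0; elim: k => [|k [s [r [ps pr rs sr r0]]]].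
  (* The polynomial of degree 1 has the single root [a 0]; for degree 0 the product is empty, so any
     sequence serves as [s]. *)
  exists a, a; split=> //=; try lia.
  - by rewrite big_geq.
  - by rewrite big_nat1 mulr1 subr0.
set p := orth_poly a b k.+2.
have [mp sp] : p \is monic /\ size p = k.+3 := monic_orth_poly a b k.+2.
have [B HB] : exists n, forall x, x >= n -> p.[x] >= 1.
  by rewrite -(monicP mp); apply: poly_pinfty_gt_lc; rewrite (monicP mp).
have r_gt0 i : (i <= k)%N -> 0 < r i.
  case: i => // i ik; apply: lt_trans r0 (lt_trans (rs 0%N 0%N _) (sr _ 0%N _)); lia.
(* The signs alternate along 0, the roots [r 0], ..., [r k], and a last point beyond them where [p]
   is already positive. *)
pose x i := if i is i'.+1 then if (i' <= k)%N then r i' else Num.max B (r k + 1)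
            else 0.
have [||q [pq xq qx]] := @alternating_roots _ p x k.+2 mp sp; last first.
  exists r, q; split; [exact: pr|exact: pq| | |].
  - move=> i j ij; have := qx j.+1 i; rewrite /x.
    by case: ifP => [|]; [move=> _; apply; lia|lia].
  - move=> i j ij; have := xq j.+1 i; rewrite /x.
    by case: ifP => [|]; [move=> _; apply; lia|lia].
  - by apply: (xq 0%N 0%N).
- case=> [|i] ik; rewrite /x; first exact: (sign_orth_poly0 b k.+2 a0).
  case: ifP => ik'.
    have : 0 < (-1) ^+ (k - i) * (orth_poly a b k).[r i].
      rewrite ps horner_prod.
      under eq_bigr => j _ do rewrite hornerXsubC.
      by apply: sign_prod_sub => // j h; [apply: sr; lia|apply: rs].
    rewrite /p (horner_orth_polyS a b k.+1).
    have -> : (orth_poly a b k.+1).[r i] = 0.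
      apply/rootP; rewrite pr -(big_map r xpredT (fun y => 'X - y%:P)).
      by rewrite root_prod_XsubC map_f // mem_index_iota.
    rewrite mulr0 sub0r subSS subSn // exprS mulN1r mulrNN mulrCA => ?.
    by apply: mulr_gt0 => //; apply: mulr_gt0 (r_gt0 _ _) (b0 _).
  have -> : i = k.+1 by lia.
  rewrite subnn expr0 mul1r; apply: lt_le_trans ltr01 (HB _ _).
  by rewrite le_max lexx.
- case=> [|i] ik; rewrite /x /=; first exact: r0.
  case: ifP => [i1|]; last by lia.
  case: ifP => i2.
    apply: lt_trans (rs i i _) (sr _ _ _); lia.
  have -> : i = k by lia.
  by rewrite lt_max ltrDl ltr01 orbT.
Qed.

Lemma orth_poly_pos_roots (R : rcfType) (a b : nat -> R) k :
  (forall k, 0 < a k) -> (forall k, 0 < b k) ->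
  exists rs : seq R, [/\ uniq rs, size rs = k.+1,
    forall z, root (orth_poly a b k.+1) z = (z \in rs) &
    forall z, z \in rs -> 0 < z].
Proof.
move=> a0 b0; have [s [r [_ pr rs sr r0]]] := orth_poly_interlacing k a0 b0.
have incr i j : (i < j <= k)%N -> r i < r j.
  by move=> ij; apply: lt_trans (rs i i _) (sr j i _); lia.
exists (map r (index_iota 0 k.+1)); split.
- rewrite map_inj_in_uniq ?iota_uniq // => i j.
  rewrite !mem_index_iota /= => im jm rij; apply/eqP.
  rewrite eqn_leq; apply/andP; split; rewrite leqNgt; apply/negP => ij.
    have : r j < r i by apply: incr; lia.
    by rewrite rij ltxx.
  have : r i < r j by apply: incr; lia.
  by rewrite rij ltxx.
- by rewrite size_map size_iota subn0.
- by move=> z; rewrite pr -(big_map r xpredT (fun y => 'X - y%:P)) root_prod_XsubC.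
- move=> z /mapP[[|i]]; rewrite mem_index_iota => ik -> //.
  by apply: lt_trans r0 (incr _ _ _).
Qed.

(** * Entries of the pencil and its action on vectors *)

(** Past the end, [inord] falls back to index 0, so the extended sequence is positive as soon as [a]
    is. *)
Definition diag_seq (R : realType) (n : nat) (a : 'I_n.+1 -> R) (k : nat) : R :=
  a (inord k).

(* The value 1 past the end keeps the extended sequence positive. *)
Definition offdiag_seq (R : realType) (n : nat) (b : 'I_n -> R) (k : nat) : R :=
  oapp b 1 (insub k).

Lemma sum_indicator (R : realType) (m k : nat) (h : nat -> R) :
  \sum_(j < m) (j == k :> nat)%:R * h j = (k < m)%:R * h k.
Proof.
case: (ltnP k m) => km.
  rewrite (bigD1 (Ordinal km)) //= eqxx big1 ?addr0 // => j jk.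
  by rewrite (_ : (j == k :> nat) = false) ?mul0r //; apply/negbTE.
rewrite big1 ?mul0r // => j _; case: eqP => [jk|]; last by rewrite mul0r.
by move: (ltn_ord j); rewrite jk ltnNge km.
Qed.

Lemma LmxE (R : realType) (n : nat) (a : 'I_n.+1 -> R) i j :
  Lmx a i j = (i == j :> nat)%:R * diag_seq a i + (j == i.+1 :> nat)%:R.
Proof.
rewrite /Lmx /diag_seq inord_val !mxE summxE; congr (_ + _).
  by rewrite mulrb -val_eqE mulr_natl mulrb.
under eq_bigr => k _ do rewrite mxE.
have -> : \sum_(k < n) ((i == widen_ord (leqnSn n) k) && (j == lift ord0 k))%:R
   = \sum_(k < n) (k == i :> nat)%:R * (j == k.+1 :> nat)%:R :> R.
  apply: eq_bigr => k _; rewrite -natrM mulnb; congr (_ && _)%:R.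
  by rewrite -val_eqE /= eq_sym.
rewrite (sum_indicator n i (fun k => (j == k.+1 :> nat)%:R)) -natrM mulnb.
by congr (_%:R); case: eqP; rewrite ?andbF ?andbT // => <-; have := ltn_ord j; lia.
Qed.

Lemma MmxE (R : realType) (n : nat) (b : 'I_n -> R) i j :
  Mmx b i j = (i == j :> nat)%:R - (i == j.+1 :> nat)%:R * offdiag_seq b j.
Proof.
rewrite /Mmx !mxE summxE; congr (_ - _).
under eq_bigr => k _ do rewrite !mxE.
have -> : \sum_(k < n) b k * ((i == lift ord0 k) && (j == widen_ord (leqnSn n) k))%:R
   = \sum_(k < n) (k == j :> nat)%:R * ((i == k.+1 :> nat)%:R * offdiag_seq b k).
  apply: eq_bigr => k _; rewrite mulrA -natrM mulnb mulrC andbC; congr ((_ && _)%:R * _).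
    by rewrite -val_eqE /= eq_sym.
  by rewrite /offdiag_seq valK.
rewrite (sum_indicator n j (fun k => (i == k.+1 :> nat)%:R * offdiag_seq b k)).
rewrite mulrA -natrM mulnb; congr (_%:R * _).
by case: eqP; rewrite ?andbF ?andbT // => ij; have := ltn_ord i; lia.
Qed.

Definition pencil (R : realType) (n : nat) (a : 'I_n.+1 -> R) (b : 'I_n -> R)
  (z : R) : 'M[R]_n.+1 := z *: Mmx b - Lmx a.

Lemma pencilE (R : realType) (n : nat) (a : 'I_n.+1 -> R) (b : 'I_n -> R) z i j :
  pencil a b z i j = (i == j :> nat)%:R * (z - diag_seq a i)
  - (j == i.+1 :> nat)%:R - (i == j.+1 :> nat)%:R * (z * offdiag_seq b j).
Proof.
have -> : pencil a b z i j = z * Mmx b i j - Lmx a i j.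
  by rewrite /pencil; move: (Mmx b) (Lmx a) => M L; rewrite !mxE.
by rewrite LmxE MmxE; ring.
Qed.

(** Vectors come from sequences on [nat], which turns each row into one step of the recurrence; the
    factor [(i < n)] masks the entry just past the end. *)
Lemma pencil_mul_col (R : realType) (n : nat) (a : 'I_n.+1 -> R) (b : 'I_n -> R)
    (z : R) (f : nat -> R) (i : 'I_n.+1) :
  (pencil a b z *m \col_j f j) i ord0 =
  (z - diag_seq a i) * f i
  - (if i : nat is k.+1 then z * offdiag_seq b k * f k else 0)
  - (i < n)%:R * f i.+1.
Proof.
rewrite mxE.
under eq_bigr => j _ do rewrite pencilE mxE.
pose g k := (z - diag_seq a i) * f k.
pose h k := z * offdiag_seq b k * f k.
rewrite (eq_bigr (fun j : 'I_n.+1 => (j == i :> nat)%:R * g j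
   - (j.+1 == i :> nat)%:R * h j - (j == i.+1 :> nat)%:R * f j)); last first.
  move=> j _; rewrite /g /h (eq_sym (i : nat) j) (eq_sym (i : nat) j.+1).
  by case: eqP => [->|_]; ring.
rewrite !sumrB !sum_indicator ltn_ord mul1r ltnS; congr (_ - _ - _).
case: i {g} => -[|k] /= ik; first by rewrite big1 // => j _; rewrite mul0r.
under eq_bigr => j _ do rewrite eqSS.
by rewrite sum_indicator ltnW // mul1r.
Qed.

Lemma row_mul_pencil (R : realType) (n : nat) (a : 'I_n.+1 -> R) (b : 'I_n -> R)
    (z : R) (f : nat -> R) (j : 'I_n.+1) :
  ((\row_j f j) *m pencil a b z) ord0 j =
  (z - diag_seq a j) * f j
  - (if j : nat is k.+1 then f k else 0)
  - (j < n)%:R * (z * offdiag_seq b j * f j.+1).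
Proof.
rewrite mxE.
under eq_bigr => i _ do rewrite pencilE mxE.
pose g k := (z - diag_seq a k) * f k.
pose h k := z * offdiag_seq b j * f k.
rewrite (eq_bigr (fun i : 'I_n.+1 => (i == j :> nat)%:R * g i
   - (j == i.+1 :> nat)%:R * f i - (i == j.+1 :> nat)%:R * h i)); last first.
  move=> i _; rewrite /g /h; by case: (eqVneq (i : nat) j) => [->|_]; ring.
rewrite !sumrB !sum_indicator ltn_ord mul1r ltnS; congr (_ - _ - _).
  case: j {g h} => -[|k] /= jk; first by rewrite big1 // => i _; rewrite mul0r.
  under eq_bigr => i _ do rewrite eqSS eq_sym.
  by rewrite sum_indicator ltnW // mul1r.
Qed.

(** * Eigenvectors and eigenvalues of the pencil *)

Definition right_vec (R : realType) (n : nat) (a : 'I_n.+1 -> R) (b : 'I_n -> R)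
    (z : R) : 'cV[R]_n.+1 :=
  \col_j (orth_poly (diag_seq a) (offdiag_seq b) j).[z].

(** Column [k'] of the equation u (z M - L) = 0, solved for the next entry of u; the divisor is the
    subdiagonal entry up to sign. *)
Fixpoint left_seq (R : realType) (a b : nat -> R) (z : R) (k : nat) : R :=
  if k is k'.+1 then
    ((z - a k') * left_seq a b z k'
     - (if k' is k''.+1 then left_seq a b z k'' else 0)) / (z * b k')
  else 1.

Definition left_vec (R : realType) (n : nat) (a : 'I_n.+1 -> R) (b : 'I_n -> R)
    (z : R) : 'cV[R]_n.+1 :=
  \col_j left_seq (diag_seq a) (offdiag_seq b) z j.

(** Stands in for [pencil_poly]: the two have the same roots ([root_pencil_poly]), and [pencil_eig]
    depends on the roots only ([pencil_eig_eq]). *)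
Definition char_orth (R : realType) (n : nat) (a : 'I_n.+1 -> R) (b : 'I_n -> R) :=
  orth_poly (diag_seq a) (offdiag_seq b) n.+1.

Lemma col_inord (R : realType) (n : nat) (v : 'cV[R]_n.+1) :
  v = \col_j v (inord j) ord0.
Proof. by apply/matrixP => i j; rewrite mxE ord1 inord_val. Qed.

Section Pencil.
Variables (R : realType) (n : nat) (a : 'I_n.+1 -> R) (b : 'I_n -> R).
Implicit Types (z : R) (v u : 'cV[R]_n.+1).
Local Notation G := (pencil a b).

Lemma right_vec0 z : right_vec a b z ord0 ord0 = 1.
Proof. by rewrite mxE hornerC. Qed.

Lemma left_vec0 z : left_vec a b z ord0 ord0 = 1.
Proof. by rewrite mxE. Qed.

(** Every row but the last is the recurrence itself. The last row lacks the next entry of the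
    sequence, which is the value of [char_orth]. *)
Lemma pencil_right_vec z (i : 'I_n.+1) :
  (G z *m right_vec a b z) i ord0 = (i == n :> nat)%:R * (char_orth a b).[z].
Proof.
rewrite (pencil_mul_col _ _ _ (fun j => (orth_poly _ _ j).[z])).
rewrite -horner_orth_polyS /char_orth.
case: (eqVneq (i : nat) n) => [->|ni]; first by rewrite ltnn mul0r subr0 mul1r.
by rewrite ltn_neqAle ni -ltnS ltn_ord mul0r mul1r subrr.
Qed.

(** The superdiagonal of [G z] is -1, so row [k] determines entry [k.+1]. Only the first [n] rows
    enter, so the lemma applies at any z, in particular to a solution of G y = c e_n. *)
Lemma right_vec_uniq z v :
  (forall i : 'I_n.+1, (i < n)%N -> (G z *m v) i ord0 = 0) ->
  v = v ord0 ord0 *: right_vec a b z.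
Proof.
move=> Gv; pose f k : R := v (inord k) ord0.
have f0 : f 0%N = v ord0 ord0 by rewrite /f (inord_val ord0).
have vf : v = \col_j f j := col_inord v.
suff fE k : (k <= n)%N -> f k = f 0%N * (orth_poly (diag_seq a) (offdiag_seq b) k).[z].
  apply/matrixP => i j; rewrite !mxE ord1 -f0 -fE -1?ltnS //.
  by rewrite /f inord_val.
have [k1] := ubnP k; elim: k1 k => // k1 IH [|k] hk kn; first by rewrite hornerC mulr1.
have ik : (inord k : 'I_n.+1) = k :> nat by apply: inordK; lia.
have := Gv (inord k); rewrite ik => /(_ kn).
rewrite vf pencil_mul_col ik kn mul1r => /eqP.
rewrite subr_eq0 => /eqP <-; rewrite horner_orth_polyS IH // 1?ltnW //.
case: k hk kn {ik} => [|k] hk kn; first by ring.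
by rewrite (IH k); [ring|lia|lia].
Qed.

Lemma left_vec_uniq z u : 0 < z -> (forall k, 0 < b k) ->
  (forall j : 'I_n.+1, (j < n)%N -> (u^T *m G z) ord0 j = 0) ->
  u = u ord0 ord0 *: left_vec a b z.
Proof.
move=> z0 b0 Gu; pose f k : R := u (inord k) ord0.
have f0 : f 0%N = u ord0 ord0 by rewrite /f (inord_val ord0).
have uf : u = \col_j f j := col_inord u.
have ufT : u^T = \row_j f j by rewrite uf; apply/matrixP => i j; rewrite !mxE.
suff fE k : (k <= n)%N -> f k = f 0%N * left_seq (diag_seq a) (offdiag_seq b) z k.
  apply/matrixP => i j; rewrite !mxE ord1 -f0 -fE -1?ltnS //.
  by rewrite /f inord_val.
have [k1] := ubnP k; elim: k1 k => // k1 IH [|k] hk kn; first by rewrite mulr1.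
have ik : (inord k : 'I_n.+1) = k :> nat by apply: inordK; lia.
have := Gu (inord k); rewrite ik => /(_ kn).
rewrite ufT row_mul_pencil ik kn mul1r => /eqP.
rewrite subr_eq0 => /eqP fS.
have zb : z * offdiag_seq b k != 0.
  by rewrite mulf_neq0 ?gt_eqF // /offdiag_seq; case: insubP => //=; rewrite ?ltr01.
have -> : f k.+1 = z * offdiag_seq b k * f k.+1 / (z * offdiag_seq b k).
  by rewrite mulrAC mulfV ?mul1r.
rewrite -fS IH // 1?ltnW //= !mulrA; congr (_ / _).
case: k hk kn {ik fS zb} => [|k] hk kn; first by rewrite /=; ring.
by rewrite (IH k); [rewrite /=; ring|lia|lia].
Qed.

(** By uniqueness a kernel vector is a nonzero multiple of [right_vec], and the last entry of
    [G z *m right_vec a b z] is the value of [char_orth]. The transpose is taken because [det0P]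
    speaks of row vectors. *)
Lemma det_pencil0 z : (\det (G z) == 0) = root (char_orth a b) z.
Proof.
apply/idP/rootP.
  rewrite -det_tr => /det0P[v v0 vG].
  have Gv : G z *m v^T = 0 by rewrite -[LHS]trmxK trmx_mul trmxK vG trmx0.
  have vE : v^T = v^T ord0 ord0 *: right_vec a b z.
    by apply: right_vec_uniq => i _; rewrite Gv mxE.
  have := pencil_right_vec z ord_max; rewrite eqxx mul1r => <-.
  apply/eqP; have : v^T ord0 ord0 * (G z *m right_vec a b z) ord_max ord0 = 0.
    have := congr1 (fun B : 'cV_n.+1 => B ord_max ord0) Gv.
    by rewrite vE -scalemxAr [X in X = _]mxE [X in _ = X]mxE {1}vE mxE right_vec0 mulr1.
  move/eqP; rewrite mulf_eq0 => /orP[/eqP v00|//].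
  by case/negP: v0; rewrite -[v]trmxK vE v00 scale0r trmx0.
move=> pz; rewrite -det_tr; apply/det0P; exists (right_vec a b z)^T.
  apply/eqP => /matrixP /(_ ord0 ord0); rewrite mxE right_vec0 mxE.
  by apply/eqP; rewrite oner_eq0.
rewrite -trmx_mul -[0]trmx0; congr (_^T); apply/matrixP => i j.
by rewrite ord1 pencil_right_vec pz mulr0 mxE.
Qed.

Lemma pencil_right_root z : root (char_orth a b) z -> G z *m right_vec a b z = 0.
Proof.
move=> /rootP pz; apply/matrixP => i j.
by rewrite ord1 pencil_right_vec pz mulr0 mxE.
Qed.

(** The recurrence for [left_vec] covers all columns but the last. A zero determinant provides some
    left kernel vector, which by uniqueness is a nonzero multiple of [left_vec]. *)
Lemma pencil_left_root z : 0 < z -> (forall k, 0 < b k) ->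
  root (char_orth a b) z -> (left_vec a b z)^T *m G z = 0.
Proof.
move=> z0 b0; rewrite -det_pencil0 => /det0P[v v0 vG].
have vE : v^T = v^T ord0 ord0 *: left_vec a b z.
  by apply: left_vec_uniq => // i _; rewrite trmxK vG mxE.
have v00 : v^T ord0 ord0 != 0.
  by apply: contra v0 => /eqP v00; rewrite -[v]trmxK vE v00 scale0r trmx0.
apply: (scalerI v00); rewrite scaler0 scalemxAl.
rewrite (_ : _ *: _ = v) //.
by rewrite -[RHS]trmxK {2}vE; apply/matrixP => i j; rewrite !mxE.
Qed.

Lemma root_pencil_poly z :
  root (pencil_poly (Lmx a) (Mmx b)) z = root (char_orth a b) z.
Proof.
rewrite -det_pencil0 rootE; congr (_ == _).
rewrite /pencil_poly -horner_evalE -det_map_mx; congr (\det _).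
rewrite /pencil; move: (Mmx b) (Lmx a) => M L.
apply/matrixP => i j; rewrite !mxE /= /horner_eval.
by rewrite hornerD hornerN hornerM hornerX !hornerC.
Qed.

(** Needed for [rootsR] to list all the roots. Otherwise the monic [char_orth], of degree [n.+1],
    would vanish at [n.+2] integers. *)
Lemma pencil_poly_neq0 : pencil_poly (Lmx a) (Mmx b) != 0.
Proof.
apply/negP => /eqP p0.
have [m _] := monic_orth_poly (diag_seq a) (offdiag_seq b) n.+1.
have allroot z : root (char_orth a b) z by rewrite -root_pencil_poly p0 root0.
have [_ sz] := monic_orth_poly (diag_seq a) (offdiag_seq b) n.+1.
have /(_ (monic_neq0 m)) :=
  @max_poly_roots R (char_orth a b) [seq i%:R | i <- iota 0 n.+2].
rewrite size_map size_iota sz ltnn => h; apply/notF/h; first by apply/allP.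
by rewrite map_inj_uniq ?iota_uniq // => i j /eqP; rewrite eqr_nat => /eqP.
Qed.

Lemma mem_rootsR_pencil z :
  (z \in rootsR (pencil_poly (Lmx a) (Mmx b))) = root (char_orth a b) z.
Proof. by rewrite -(roots_on_rootsR pencil_poly_neq0) in_itv /= root_pencil_poly. Qed.

Lemma diag_seq_gt0 : (forall i, 0 < a i) -> forall k, 0 < diag_seq a k.
Proof. by move=> a0 k; apply: a0. Qed.

Lemma offdiag_seq_gt0 : (forall i, 0 < b i) -> forall k, 0 < offdiag_seq b k.
Proof.
by move=> b0 k; rewrite /offdiag_seq; case: insubP => //= _; rewrite ltr01.
Qed.

(** The polynomial has [n.+1] distinct positive roots, so the sorted list has full length and
    indexing never reaches the default value 0. *)
Lemma pencil_eigP : (forall i, 0 < a i) -> (forall k, 0 < b k) ->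
  let lambda := pencil_eig (Lmx a) (Mmx b) in
  [/\ forall j : 'I_n.+1, 0 < lambda j,
      forall j : 'I_n.+1, root (char_orth a b) (lambda j) &
      injective (fun j : 'I_n.+1 => lambda j)].
Proof.
move=> a0 b0 lambda.
have [rs [urs srs mrs rs0]] :=
  orth_poly_pos_roots n (diag_seq_gt0 a0) (offdiag_seq_gt0 b0).
set s := rootsR (pencil_poly (Lmx a) (Mmx b)).
have ms z : (z \in s) = (z \in rs) by rewrite mem_rootsR_pencil -mrs.
have us : uniq s by apply: lt_sorted_uniq; apply: sorted_roots.
have ss : size s = n.+1.
  by rewrite -srs; apply/eqP; rewrite -(uniq_size_uniq urs) // => z; rewrite ms.
have mem (j : 'I_n.+1) : lambda j \in s by apply: mem_nth; rewrite ss.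
split.
- by move=> j; apply: rs0; rewrite -ms.
- by move=> j; rewrite -mem_rootsR_pencil.
- move=> i j /eqP; rewrite /lambda /pencil_eig nth_uniq ?ss // => /eqP.
  exact: val_inj.
Qed.

End Pencil.

Lemma pencil_eig_eq (R : realType) (n : nat) (a a' : 'I_n.+1 -> R) (b b' : 'I_n -> R) :
  root (char_orth a b) =1 root (char_orth a' b') ->
  pencil_eig (Lmx a) (Mmx b) =1 pencil_eig (Lmx a') (Mmx b').
Proof.
move=> eqr j; rewrite /pencil_eig; congr (_`_ _).
apply: lt_sorted_eq; try exact: sorted_roots.
by move=> z; rewrite !mem_rootsR_pencil eqr.
Qed.

(** * Diagonalization and functions of matrices *)

Lemma eigenrows_unit (F : fieldType) (n : nat) (X S : 'M[F]_n.+1)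
    (lambda : 'I_n.+1 -> F) :
  injective lambda -> S *m X = diag_mx (\row_i lambda i) *m S ->
  (forall i, S i ord0 != 0) -> S \in unitmx.
Proof.
move=> inj SX S0; rewrite unitmxE unitfE; apply/negP => /det0P[c c0 cS].
(* The left kernel of S is stable under diag(lambda), hence under polynomials
   in it, and a suitable one isolates the entry j. *)
have stable (s : seq 'I_n.+1) :
    (\row_j (c ord0 j * \prod_(i <- s) (lambda j - lambda i))) *m S = 0.
  elim: s => [|i s IH].
    by rewrite -[RHS]cS; congr (_ *m _); apply/rowP => j; rewrite mxE big_nil mulr1.
  set v := \row_j _ in IH.
  rewrite (_ : \row_j _ = v *m diag_mx (\row_i lambda i) - lambda i *: v); last first.
    apply/rowP => j; rewrite mul_mx_diag !mxE big_cons; ring.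
  by rewrite mulmxBl -mulmxA -SX mulmxA -scalemxAl IH mul0mx scaler0 subr0.
case/eqP: c0; apply/rowP => j; rewrite mxE.
(* The product over all indices except [j] vanishes at every other eigenvalue. Column 0 is inspected
   because [S j ord0] is nonzero. *)
have := stable (rem j (enum 'I_n.+1)); move=> /matrixP /(_ ord0 ord0).
have us : uniq (enum 'I_n.+1) := enum_uniq _.
rewrite [RHS]mxE mxE (bigD1 j) //= mxE [X in _ + X]big1 ?addr0; last first.
  move=> i ij; rewrite mxE (bigD1_seq i) /= ?subrr ?mul0r ?mulr0 ?mul0r //.
    by rewrite mem_rem_uniq // inE ij mem_enum.
  by rewrite rem_uniq.
move/eqP; rewrite !mulf_eq0 (negbTE (S0 j)) orbF => /orP[/eqP //|].
rewrite prodf_seq_eq0 => /hasP[i]; rewrite mem_rem_uniq // inE => /andP[/= ij _].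
by rewrite subr_eq0 => /eqP /inj ji; rewrite ji eqxx in ij.
Qed.

(** [mxfun] uses an unknown diagonalization T, e. The row u T is an eigenvector of diag(e), so each
    of its entries is 0 or sits where e equals z; applying F to e then multiplies it by F z. *)
Lemma left_eigvec_mxfun (R : realType) (n : nat) (F : R -> R) (X S : 'M[R]_n)
    (d u : 'rV[R]_n) (z : R) :
  S \in unitmx -> (forall i, 0 < d ord0 i) -> S *m X = diag_mx d *m S ->
  u *m X = z *: u -> u *m mxfun F X = F z *: u.
Proof.
move=> Su d0 SX uX; rewrite /mxfun.
(* The given diagonalization shows that the set is inhabited, which rules out the default value of
   [xget]. *)
have : [set Y | exists (S : 'M[R]_n) (d : 'rV[R]_n),
    [/\ S \in unitmx, forall i, 0 < d ord0 i, X = S *m diag_mx d *m invmx S &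
        Y = S *m diag_mx (map_mx F d) *m invmx S]]
   (invmx S *m diag_mx (map_mx F d) *m invmx (invmx S)).
  exists (invmx S), d; split => //; first by rewrite unitmx_inv.
  by rewrite invmxK -mulmxA -SX mulmxA mulVmx // mul1mx.
move=> /(xgetI 0) /= [T [e [Tu e0 XT ->]]].
have uT : u *m T *m diag_mx e = z *: (u *m T).
  have : u *m X *m T = z *: u *m T by rewrite uX.
  by rewrite XT !mulmxA mulmxKV // -scalemxAl.
suff h : u *m T *m diag_mx (map_mx F e) = F z *: (u *m T).
  by rewrite !mulmxA h -scalemxAl mulmxK.
move: uT; move: (u *m T) => w /rowP wz; apply/rowP => i.
have := wz i; rewrite !mul_mx_diag !mxE mulrC => /eqP.
rewrite -subr_eq0 -mulrBl mulf_eq0 subr_eq0 => /orP[/eqP->|/eqP->]; first by rewrite mulrC.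
by rewrite mulr0 mul0r.
Qed.

Lemma col_mulmx (R : comNzRingType) (m n p : nat) (j : 'I_p) (A : 'M[R]_(m, n))
    (B : 'M[R]_(n, p)) :
  col j (A *m B) = A *m col j B.
Proof. by rewrite !colE mulmxA. Qed.

(** * Biorthogonality of the eigenvectors and the weights *)

Section Weights.
Variables (R : realType) (n : nat) (a : 'I_n.+1 -> R) (b : 'I_n -> R).
Hypothesis a0 : forall i, 0 < a i.
Hypothesis b0 : forall i, 0 < b i.
Local Notation L := (Lmx a).
Local Notation M := (Mmx b).
Let lambda (j : 'I_n.+1) := pencil_eig L M j.

Lemma Mmx_unit : M \in unitmx.
Proof.
rewrite unitmxE det_trig; last first.
  apply/is_trig_mxP => i j ij; rewrite MmxE.
  by rewrite (ltn_eqF ij) (ltn_eqF (ltnW ij : (i < j.+1)%N)) mul0r subr0.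
rewrite big1 ?unitr1 // => i _; rewrite MmxE eqxx.
by rewrite (ltn_eqF (ltnSn i)) mul0r subr0.
Qed.

Lemma row0_Mmx (N : 'cV[R]_n.+1) : (M *m N) ord0 ord0 = N ord0 ord0.
Proof.
rewrite mxE (bigD1 ord0) //= big1 ?addr0; last first.
  move=> j j0; rewrite MmxE /= mul0r subr0.
  by rewrite (_ : (0 == j)%N = false) ?mul0r //; apply/negbTE; rewrite eq_sym.
by rewrite MmxE eqxx /= mul0r subr0 mul1r.
Qed.

Lemma pencil_mulE z (v : 'cV[R]_n.+1) :
  (pencil a b z *m v == 0) = (L *m v == z *: (M *m v)).
Proof. by rewrite mulmxBl subr_eq0 eq_sym scalemxAl. Qed.

Lemma mul_pencilE z (u : 'rV[R]_n.+1) :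
  (u *m pencil a b z == 0) = (u *m L == z *: (u *m M)).
Proof. by rewrite mulmxBr subr_eq0 eq_sym scalemxAr. Qed.

Lemma right_eigvecE z : root (char_orth a b) z ->
  right_eigvec L M z = right_vec a b z.
Proof.
move=> rz; apply: xget_unique.
  split; last exact: right_vec0.
  by apply/eqP; rewrite -pencil_mulE pencil_right_root.
move=> v [/eqP]; rewrite -pencil_mulE => /eqP Gv v0.
by rewrite (@right_vec_uniq _ _ a b z v) ?v0 ?scale1r // => i _; rewrite Gv mxE.
Qed.

Lemma left_eigvecE z : 0 < z -> root (char_orth a b) z ->
  left_eigvec L M z = left_vec a b z.
Proof.
move=> z0 rz; apply: xget_unique.
  split; last exact: left_vec0.
  by apply/eqP; rewrite -mul_pencilE pencil_left_root.
move=> v [/eqP]; rewrite -mul_pencilE => /eqP Gv v0.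
by rewrite (@left_vec_uniq _ _ a b z v) ?v0 ?scale1r // => i _; rewrite Gv mxE.
Qed.

(** The inverse weight with a free spectral parameter, so that z can be held fixed while [a] and [b]
    move in time. *)
Definition pairing z : R :=
  ((left_vec a b z)^T *m M *m right_vec a b z) ord0 ord0.

Lemma spectral_weightE (j : 'I_n.+1) : spectral_weight L M j = (pairing (lambda j))^-1.
Proof.
have [l0 lr _] := pencil_eigP a0 b0.
by rewrite /spectral_weight right_eigvecE ?left_eigvecE.
Qed.

Lemma left_vec_LV z : 0 < z -> root (char_orth a b) z ->
  (left_vec a b z)^T *m L = z *: ((left_vec a b z)^T *m M).
Proof. by move=> z0 rz; apply/eqP; rewrite -mul_pencilE pencil_left_root. Qed.

Lemma right_vec_LV z : root (char_orth a b) z ->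
  L *m right_vec a b z = z *: (M *m right_vec a b z).
Proof. by move=> rz; apply/eqP; rewrite -pencil_mulE pencil_right_root. Qed.

Let U := \matrix_(j < n.+1, i < n.+1) left_vec a b (lambda j) i ord0.
Let V := \matrix_(i < n.+1, j < n.+1) right_vec a b (lambda j) i ord0.

Let rowU j : row j U = (left_vec a b (lambda j))^T.
Proof. by apply/rowP => i; rewrite !mxE. Qed.
Let colV j : col j V = right_vec a b (lambda j).
Proof. by apply/colP => i; rewrite !mxE. Qed.

Let eigU : U *m (L *m invmx M) = diag_mx (\row_j lambda j) *m U.
Proof.
have [l0 lr _] := pencil_eigP a0 b0.
suff UL : U *m L = diag_mx (\row_j lambda j) *m U *m M.
  by rewrite mulmxA UL mulmxK // Mmx_unit.
apply/row_matrixP => j; rewrite row_mul rowU left_vec_LV // -rowU -row_mul -mulmxA.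
by apply/rowP => i; rewrite mul_diag_mx !mxE.
Qed.

Let eigV : L *m V = M *m V *m diag_mx (\row_j lambda j).
Proof.
have [l0 lr _] := pencil_eigP a0 b0.
apply/matrixP => i j; rewrite mul_mx_diag [RHS]mxE [X in _ * X]mxE mulrC.
have := congr1 (fun B : 'cV_n.+1 => B i ord0) (right_vec_LV (lr j)).
by rewrite -colV -!col_mulmx [col j (L *m V) _ _]mxE => ->; rewrite !mxE.
Qed.

Let unitU : U \in unitmx.
Proof.
have [_ _ inj] := pencil_eigP a0 b0.
by apply: eigenrows_unit inj eigU _ => i; rewrite mxE left_vec0 oner_eq0.
Qed.

Let unitV : V \in unitmx.
Proof.
have [_ _ inj] := pencil_eigP a0 b0; rewrite -unitmx_tr.
apply: (@eigenrows_unit _ _ (invmx M *m L)^T _ lambda inj).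
  rewrite -trmx_mul -mulmxA eigV !mulmxA mulVmx ?Mmx_unit // mul1mx.
  by rewrite trmx_mul tr_diag_mx.
by move=> i; rewrite !mxE hornerC oner_eq0.
Qed.

(** Computing u_i L v_j from either side gives (lambda_j - lambda_i) u_i M v_j = 0, and the
    eigenvalues are distinct. *)
Let UMV : U *m M *m V = diag_mx (\row_j pairing (lambda j)).
Proof.
have [l0 lr inj] := pencil_eigP a0 b0.
set D := U *m M *m V.
have Dij i j : D i j =
    ((left_vec a b (lambda i))^T *m M *m right_vec a b (lambda j)) ord0 ord0.
  by rewrite -rowU -colV -row_mul -col_mulmx -row_mul -/D [RHS]mxE [RHS]mxE.
apply/matrixP => i j; rewrite [RHS]mxE [X in X *+ _]mxE Dij; case: eqVneq => [<-|ij] //.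
rewrite mulr0n -Dij.
have h : lambda j * D i j = lambda i * D i j.
  rewrite Dij.
  have := left_vec_LV (l0 i) (lr i).
  move=> /(congr1 (mulmx^~ (right_vec a b (lambda j)))).
  rewrite -mulmxA right_vec_LV // -scalemxAl -scalemxAr mulmxA.
  by move=> /matrixP /(_ ord0 ord0); rewrite !mxE.
move/eqP: h; rewrite -subr_eq0 -mulrBl mulf_eq0 subr_eq0 => /orP[/eqP /inj ji|/eqP //].
by rewrite ji eqxx in ij.
Qed.

Lemma pairing_neq0 (j : 'I_n.+1) : pairing (lambda j) != 0.
Proof.
have : U *m M *m V \in unitmx by rewrite !unitmx_mul unitU unitV Mmx_unit.
rewrite UMV unitmxE det_diag unitfE => /prodf_neq0 /(_ j isT).
by rewrite mxE.
Qed.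

(* Both sides are the upper left entry of the inverse of M. *)
Lemma sum_spectral_weight : \sum_(j < n.+1) spectral_weight L M j = 1.
Proof.
pose E := diag_mx (\row_j (pairing (lambda j))^-1).
have DE : diag_mx (\row_j pairing (lambda j)) *m E = 1%:M.
  rewrite mulmx_diag; apply/matrixP => i j; rewrite !mxE; case: eqP => // _.
  by rewrite mulfV ?pairing_neq0.
(* Cancelling the invertible U on the left reduces this to U M V E U = U. The corner entry of V E U
   is the sum of the inverse pairings, since all eigenvectors start with 1. *)
have MVEU : M *m (V *m E *m U) = 1%:M.
  apply: (row_full_inj (A := U)); rewrite ?row_full_unit //.
  by rewrite !mulmxA UMV DE mulmx1 mul1mx.
have := congr1 (fun B : 'M[R]_n.+1 => col ord0 B ord0 ord0) MVEU.
rewrite col_mulmx row0_Mmx !mxE eqxx => h; transitivity (true%:R : R) => //; rewrite -h.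
apply: eq_bigr => j _; rewrite mul_mx_diag !mxE spectral_weightE.
by rewrite hornerC /=; ring.
Qed.

Lemma left_vec_mxfun (F : R -> R) (j : 'I_n.+1) :
  (left_vec a b (lambda j))^T *m mxfun F (L *m invmx M) =
  F (lambda j) *: (left_vec a b (lambda j))^T.
Proof.
have [l0 lr inj] := pencil_eigP a0 b0.
apply: left_eigvec_mxfun unitU _ eigU _; first by move=> i; rewrite mxE.
by rewrite mulmxA left_vec_LV // -scalemxAl mulmxK // Mmx_unit.
Qed.

End Weights.

(** * Calculus on the time interval *)

(** Exactly the regularity that [toda_solution] provides and that the mean value theorem asks for in
    [interval_cst]. *)
Definition piecewise_diff (R : realType) (J : set R) (f : R -> R) :=
  {within J, continuous f} /\ forall t, J° t -> derivable f t 1.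

Section PiecewiseDiff.
Variables (R : realType) (J : set R).
Implicit Types f g : R -> R.
Local Notation good := (piecewise_diff J).

Lemma pdiff_cst c : good (fun=> c).
Proof. by split=> [x|t _]; [exact: cvg_cst|exact: derivable_cst]. Qed.

Lemma pdiffD f g : good f -> good g -> good (fun s => f s + g s).
Proof.
move=> [cf df] [cg dg]; split=> [x|t Jt]; first exact: continuousD (cf x) (cg x).
by apply: derivableD; [exact: df|exact: dg].
Qed.

Lemma pdiffN f : good f -> good (fun s => - f s).
Proof.
move=> [cf df]; split=> [x|t Jt]; first exact: continuousN (cf x).
by apply: derivableN; exact: df.
Qed.

Lemma pdiffM f g : good f -> good g -> good (fun s => f s * g s).
Proof.
move=> [cf df] [cg dg]; split=> [x|t Jt]; first exact: continuousM (cf x) (cg x).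
by apply: derivableM; [exact: df|exact: dg].
Qed.

Lemma pdiffB f g : good f -> good g -> good (fun s => f s - g s).
Proof. by move=> gf gg; apply: pdiffD => //; apply: pdiffN. Qed.

Lemma pdiffV f : (forall s, J s -> f s != 0) -> good f -> good (fun s => (f s)^-1).
Proof.
move=> f0 [cf df]; split=> [|t Jt].
  rewrite continuous_subspace_in => x /set_mem Jx.
  by apply: continuousV; [exact: f0|exact: cf].
by apply: derivableV; [exact: f0 (interior_subset Jt)|exact: df].
Qed.

Lemma pdiff_sum n (f : 'I_n -> R -> R) :
  (forall i, good (f i)) -> good (fun s => \sum_(i < n) f i s).
Proof.
move=> gf; elim: n f gf => [|n IH] f gf.
  by under eq_fun do rewrite big_ord0; exact: pdiff_cst.
under eq_fun do rewrite big_ord_recr /=.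
by apply: pdiffD => //; apply: IH.
Qed.

Lemma interval_cst f : is_interval J -> {within J, continuous f} ->
  (forall t, J° t -> is_derive t (1 : R) f 0) ->
  forall x y, J x -> J y -> f x = f y.
Proof.
move=> iJ cf df x y; wlog xy : x y / x <= y.
  by move=> h Jx Jy; have [/h->|/ltW/h->] := leP x y.
move=> Jx Jy.
have sub : `[x, y]%classic `<=` J.
  by move=> z /=; rewrite in_itv /= => xzy; apply: iJ Jx Jy _ xzy.
have [||c _ /eqP] := @MVT_segment R f (fun=> 0) x y xy.
- move=> z zxy; apply: df; have := interiorS sub.
  by rewrite interior_itv_bnd; apply.
- exact: continuous_subspaceW sub cf.
- by rewrite mul0r subr_eq0 => /eqP ->.
Qed.

End PiecewiseDiff.

(** * Entrywise derivatives and strictly lower triangular matrices *)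

Definition is_derive_mx (R : realType) (m n : nat) (t : R) (A : R -> 'M[R]_(m, n))
  (A' : 'M[R]_(m, n)) := forall i j, is_derive t (1 : R) (fun s => A s i j) (A' i j).

Lemma is_derive_mxP (R : realType) (m n : nat) (t : R) (A : R -> 'M[R]_(m, n)) A' :
  is_derive t (1 : R) A A' -> is_derive_mx t A A'.
Proof.
move=> dA i j; have dvA : derivable A t 1 by apply: ex_derive.
have /derivable_mxP/(_ i j) dij := dvA.
apply: DeriveDef => //; rewrite -(@derive_val _ _ _ _ _ _ _ dA).
by rewrite (derive_mx dvA) mxE.
Qed.

Lemma is_derive_mulmx (R : realType) (m n p : nat) (t : R)
    (A : R -> 'M[R]_(m, n)) (B : R -> 'M[R]_(n, p)) A' B' :
  is_derive_mx t A A' -> is_derive_mx t B B' ->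
  is_derive_mx t (fun s => A s *m B s) (A' *m B t + A t *m B').
Proof.
move=> dA dB i j.
have -> : (fun s => (A s *m B s) i j) =
    \sum_(k < n) ((fun s => A s i k) * (fun s => B s k j)).
  by apply/funext => s; rewrite mxE fct_sumE.
rewrite !mxE -big_split /=; apply: is_derive_sum => k.
apply: is_derive_eq (is_deriveM (dA i k) (dB k j)) _.
by rewrite /GRing.scale /=; ring.
Qed.

Lemma is_derive_mx_uniq (R : realType) (m n : nat) (t : R) (A : R -> 'M[R]_(m, n)) A1 A2 :
  is_derive_mx t A A1 -> is_derive_mx t A A2 -> A1 = A2.
Proof.
move=> d1 d2; apply/matrixP => i j.
by rewrite -(@derive_val _ _ _ _ _ _ _ (d1 i j)) (@derive_val _ _ _ _ _ _ _ (d2 i j)).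
Qed.

Lemma strict_lower_row0 (R : realType) (n m : nat) (X : 'M[R]_n.+1)
    (v : 'M[R]_(n.+1, m)) j :
  (strict_lower X *m v) ord0 j = 0.
Proof. by rewrite mxE big1 // => k _; rewrite mxE mul0r. Qed.

(** In column 0, passing to the strictly lower part removes the top entry only. This evaluates the
    factor c in the equation of the left eigenvectors. *)
Lemma mulmx_strict_lower_col0 (R : realType) (n : nat) (X : 'M[R]_n.+1)
    (u : 'rV[R]_n.+1) :
  (u *m strict_lower X) ord0 ord0 = (u *m X) ord0 ord0 - u ord0 ord0 * X ord0 ord0.
Proof.
rewrite !mxE 2!big_ord_recl !mxE /= mulr0 add0r addrC addKr.
by apply: eq_bigr => k _; rewrite mxE.
Qed.

Lemma strict_lower_mul_last (R : realType) (n : nat) (X : 'M[R]_n.+1) (v : 'cV[R]_n.+1) :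
  (forall i : 'I_n.+1, (i < n)%N -> v i ord0 = 0) -> strict_lower X *m v = 0.
Proof.
move=> v0; apply/matrixP => i j; rewrite ord1 !mxE big1 // => k _; rewrite mxE.
case: ifP => [ki|]; last by rewrite mul0r.
by rewrite v0 ?mulr0 // (leq_trans ki) // -ltnS.
Qed.

(** * Evolution of the spectral data along the flow *)

Section Flow.
Variables (R : realType) (n : nat) (F : R -> R) (J : set R).
Variables (a : R -> 'I_n.+1 -> R) (b : R -> 'I_n -> R).
Hypothesis hJ : is_interval J.
Hypothesis hsol : toda_solution F J a b.

Let L t := Lmx (a t).
Let M t := Mmx (b t).
Let X t := mxfun F (L t *m invmx (M t)).
Let A t := strict_lower (X t).
Let B t := strict_lower (mxfun F (invmx (M t) *m L t)).

Let a_gt0 t : J t -> forall i, 0 < a t i.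
Proof. by case: hsol => h _ _ _ _ /h[]. Qed.

Let b_gt0 t : J t -> forall i, 0 < b t i.
Proof. by case: hsol => h _ _ _ _ /h[]. Qed.

Let dL t : J° t -> is_derive_mx t L (A t *m L t - L t *m B t).
Proof. by move=> Jt; apply: is_derive_mxP; case: hsol => _ _ _ h _; exact: h. Qed.

Let dM t : J° t -> is_derive_mx t M (A t *m M t - M t *m B t).
Proof. by move=> Jt; apply: is_derive_mxP; case: hsol => _ _ _ _; exact. Qed.

Let pdiffL i j : piecewise_diff J (fun s => L s i j).
Proof.
split=> [|t Jt]; last by case: (dL Jt i j).
case: hsol => _ cL _ _ _; apply: (@within_continuous_comp _ _ _ J L (fun N => N i j)) cL.
by move=> N _; exact: coord_continuous.
Qed.

Let pdiff_Mmx i j : piecewise_diff J (fun s => M s i j).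
Proof.
split=> [|t Jt]; last by case: (dM Jt i j).
case: hsol => _ _ cM _ _; apply: (@within_continuous_comp _ _ _ J M (fun N => N i j)) cM.
by move=> N _; exact: coord_continuous.
Qed.

Let pdiff_diag k : piecewise_diff J (fun s => diag_seq (a s) k).
Proof.
rewrite (_ : (fun _ => _) = fun s => L s (inord k) (inord k)); first exact: pdiffL.
apply/funext => s; rewrite /L LmxE eqxx mul1r /diag_seq inord_val.
by rewrite (ltn_eqF (ltnSn _)) addr0.
Qed.

Let pdiff_offdiag k : piecewise_diff J (fun s => offdiag_seq (b s) k).
Proof.
case: (ltnP k n) => kn; last first.
  rewrite (_ : (fun _ => _) = fun=> 1); first exact: pdiff_cst.
  by apply/funext => s; rewrite /offdiag_seq insubN // -leqNgt.
rewrite (_ : (fun _ => _) = fun s => - M s (inord k.+1) (inord k)).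
  exact: pdiffN.
have ik : (inord k : 'I_n.+1) = k :> nat by apply: inordK; lia.
have ik1 : (inord k.+1 : 'I_n.+1) = k.+1 :> nat by apply: inordK; lia.
apply/funext => s; rewrite /M MmxE ik ik1 eqxx mul1r.
by rewrite (gtn_eqF (ltnSn _)) sub0r opprK.
Qed.

Let pdiff_right z k :
  piecewise_diff J (fun s => (orth_poly (diag_seq (a s)) (offdiag_seq (b s)) k).[z]).
Proof.
have [k1] := ubnP k; elim: k1 k => // k1 IH [|k] hk.
  by under eq_fun do rewrite hornerC; exact: pdiff_cst.
under eq_fun do rewrite horner_orth_polyS.
apply: pdiffB.
  by apply: pdiffM; [apply: pdiffB => //; exact: pdiff_cst|apply: IH; lia].
case: k hk => [|k] hk; first exact: pdiff_cst.
by do ?apply: pdiffM => //; [exact: pdiff_cst|apply: IH; lia].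
Qed.

Let pdiff_left z k : 0 < z ->
  piecewise_diff J (fun s => left_seq (diag_seq (a s)) (offdiag_seq (b s)) z k).
Proof.
move=> z0; have [k1] := ubnP k; elim: k1 k => // k1 IH [|k] hk.
  exact: pdiff_cst.
apply: pdiffM; last first.
  apply: pdiffV; last by apply: pdiffM => //; exact: pdiff_cst.
  by move=> s Js; rewrite mulf_neq0 ?gt_eqF // offdiag_seq_gt0 //; exact: b_gt0.
apply: pdiffB.
  by apply: pdiffM; [apply: pdiffB => //; exact: pdiff_cst|apply: IH; lia].
case: k hk => [|k] hk; first exact: pdiff_cst.
by apply: IH; lia.
Qed.

Let pdiff_right_vec z i j : piecewise_diff J (fun s => right_vec (a s) (b s) z i j).
Proof. by under eq_fun do rewrite mxE; exact: pdiff_right. Qed.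

Let pdiff_left_vec z i j : 0 < z ->
  piecewise_diff J (fun s => (left_vec (a s) (b s) z)^T i j).
Proof. by move=> z0; under eq_fun do rewrite !mxE; exact: pdiff_left. Qed.

Let dpencil z t : J° t -> is_derive_mx t (fun s => pencil (a s) (b s) z)
  (A t *m pencil (a t) (b t) z - pencil (a t) (b t) z *m B t).
Proof.
move=> Jt i j.
rewrite (_ : (fun s => _) = z *: (fun s => M s i j) - (fun s => L s i j)); last first.
  apply/funext => s; rewrite /pencil -/(M s) -/(L s) !fctE /=.
  by move: (M s) (L s) => M' L'; rewrite !mxE.
apply: is_derive_eq (is_deriveB (is_deriveZ z (dM Jt i j)) (dL Jt i j)) _.
rewrite /pencil -/(M t) -/(L t); move: (M t) (L t) (A t) (B t) => M' L' A' B'.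
rewrite mulmxBr mulmxBl -!scalemxAr -!scalemxAl.
by move: (A' *m M') (M' *m B') (A' *m L') (L' *m B') => U V W Y;
  rewrite !mxE /GRing.scale /=; ring.
Qed.

(* A e_n = 0, and v' - B v has first entry 0, so it vanishes by uniqueness. *)
Lemma derive_right_vec z t : J° t ->
  is_derive_mx t (fun s => right_vec (a s) (b s) z) (B t *m right_vec (a t) (b t) z) /\
  is_derive t (1 : R) (fun s => (char_orth (a s) (b s)).[z]) 0.
Proof.
move=> Jt; set v := fun s => right_vec (a s) (b s) z.
set p := fun s => (char_orth (a s) (b s)).[z].
pose G s := pencil (a s) (b s) z.
pose v' := \matrix_(i, j) 'D_1 (fun s => v s i j) t.
have dv : is_derive_mx t v v'.
  move=> i j; rewrite mxE; apply: derivableP.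
  by have [_ h] := pdiff_right_vec z i j; exact: h.
have dp : is_derive t (1 : R) p ('D_1 p t).
  by apply: derivableP; have [_ h] := pdiff_right z n.+1; exact: h.
have Gv s i : (G s *m v s) i ord0 = (i == n :> nat)%:R * p s := pencil_right_vec _ _ _ _.
have AGv : A t *m (G t *m v t) = 0.
  by apply: strict_lower_mul_last => i ni; rewrite Gv (ltn_eqF ni) mul0r.
pose y := v' - B t *m v t.
(* Differentiating G v = p e_n gives A G v + G (v' - B v) = p' e_n, where the first term is zero by
   [AGv]. *)
have Gy i : (G t *m y) i ord0 = (i == n :> nat)%:R * 'D_1 p t.
  have d1 := is_derive_mulmx (dpencil z Jt) dv i ord0.
  have d2 : is_derive t (1 : R) (fun s => (G s *m v s) i ord0)
      ((i == n :> nat)%:R * 'D_1 p t).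
    rewrite (_ : (fun s => _) = (i == n :> nat)%:R *: p); first exact: is_deriveZ.
    by apply/funext => s; rewrite Gv.
  have := @derive_val _ _ _ _ _ _ _ d1; rewrite (@derive_val _ _ _ _ _ _ _ d2) => ->.
  suff -> : G t *m y = (A t *m G t - G t *m B t) *m v t + G t *m v' by [].
  move: AGv; rewrite /y; move: (G t) (v t) => G0 v0 AGv.
  by rewrite mulmxBl mulmxBr -!mulmxA AGv sub0r addrC.
have y0 : y = 0.
  rewrite (@right_vec_uniq _ _ (a t) (b t) z y); last first.
    by move=> i ni; rewrite Gy (ltn_eqF ni) mul0r.
  rewrite (_ : y ord0 ord0 = 0) ?scale0r // [LHS]mxE
    [X in _ + X]mxE strict_lower_row0 subr0.
  have := dv ord0 ord0; rewrite (_ : (fun s => v s ord0 ord0) = cst 1).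
    move=> h; rewrite -(@derive_val _ _ _ _ _ _ _ h); exact: derive_val.
  by apply/funext => s; rewrite /v right_vec0.
split; first by move/eqP: y0; rewrite subr_eq0 => /eqP <-.
have := Gy ord_max; rewrite y0 mulmx0 mxE eqxx mul1r => p0.
by rewrite p0.
Qed.

Lemma root_char_orth_cst s t : J s -> J t ->
  root (char_orth (a s) (b s)) =1 root (char_orth (a t) (b t)).
Proof.
move=> Js Jt z; rewrite !rootE; congr (_ == 0).
apply: (@interval_cst R J (fun s => (char_orth (a s) (b s)).[z])) Js Jt => //.
  by have [] := pdiff_right z n.+1.
by move=> x /(derive_right_vec z)[].
Qed.

Lemma pencil_eig_cst s t : J s -> J t ->
  pencil_eig (Lmx (a s)) (Mmx (b s)) =1 pencil_eig (Lmx (a t)) (Mmx (b t)).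
Proof. by move=> Js Jt; apply/pencil_eig_eq/root_char_orth_cst. Qed.

(** As z stays an eigenvalue on J, u G = 0 can be differentiated: (u' + u A) G = 0. By uniqueness u'
    + u A is a multiple of u, with factor its first entry (u A)_0 because u_0 is constantly 1. *)
Lemma derive_left_vec z t : J° t -> 0 < z -> root (char_orth (a t) (b t)) z ->
  let u s := (left_vec (a s) (b s) z)^T in
  is_derive_mx t u ((u t *m A t) ord0 ord0 *: u t - u t *m A t).
Proof.
move=> Jt z0 rz u.
pose G s := pencil (a s) (b s) z.
have Jt' := interior_subset Jt.
have uG s : J s -> u s *m G s = 0.
  move=> Js; apply: pencil_left_root => //; first exact: b_gt0.
  by rewrite (root_char_orth_cst Js Jt').
pose u' := \matrix_(i, j) 'D_1 (fun s => u s i j) t.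
have du : is_derive_mx t u u'.
  move=> i j; rewrite mxE; apply: derivableP.
  by have [_ h] := pdiff_left_vec i j z0; exact: h.
have yG : (u' + u t *m A t) *m G t = 0.
  transitivity (u' *m G t + u t *m (A t *m G t - G t *m B t)).
    move: (uG t Jt'); move: (G t) (u t) => G0 u0 uG0.
    by rewrite mulmxDl mulmxBr !mulmxA uG0 mul0mx subr0.
  apply: is_derive_mx_uniq (is_derive_mulmx du (dpencil z Jt)) _ => i j.
  (* The product u G is known to vanish on J only, which is a neighbourhood of the interior point
     [t]. *)
  rewrite mxE; apply: near_eq_is_derive (is_derive_cst _ _ _).
  by near=> s; rewrite uG ?mxE //; near: s; exact: Jt.
have u'0 : u' ord0 ord0 = 0.
  have := du ord0 ord0; rewrite (_ : (fun s => u s ord0 ord0) = cst 1).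
    move=> h; rewrite -(@derive_val _ _ _ _ _ _ _ h); exact: derive_val.
  by apply/funext => s; rewrite /u mxE left_vec0.
have yE : u' + u t *m A t = (u t *m A t) ord0 ord0 *: u t.
  rewrite -[LHS]trmxK (@left_vec_uniq _ _ (a t) (b t) z _^T z0 (b_gt0 Jt')).
    by rewrite linearZ /= mxE mxE u'0 add0r.
  by move=> j _; rewrite trmxK yG mxE.
by rewrite -yE addrK.
Unshelve. all: by end_near.
Qed.

Let lambda s (j : 'I_n.+1) := pencil_eig (L s) (M s) j.

(** The eigenvalue is frozen at time [s]. With u' = c u - u A, M' = A M - M B and v' = B v, the
    terms in A and B cancel in (u M v)', leaving c u M v. *)
Lemma derive_pairing s t j : J s -> J° t ->
  is_derive t (1 : R) (fun x => pairing (a x) (b x) (lambda s j))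
    ((F (lambda s j) - X t ord0 ord0) * pairing (a t) (b t) (lambda s j)).
Proof.
move=> Js Jt; have Jt' := interior_subset Jt.
have eqz : lambda s j = lambda t j by apply: pencil_eig_cst.
have [l0 lr _] := pencil_eigP (a_gt0 Jt') (b_gt0 Jt').
have z0 : 0 < lambda s j by rewrite eqz; exact: l0.
have rz : root (char_orth (a t) (b t)) (lambda s j) by rewrite eqz; exact: lr.
have uX := left_vec_mxfun (a_gt0 Jt') (b_gt0 Jt') F j.
rewrite -/(L t) -/(M t) -/(lambda t j) -eqz -/(X t) in uX.
move: uX z0 rz; set z := lambda s j => uX z0 rz.
have du := derive_left_vec Jt z0 rz.
have [dv _] := derive_right_vec z Jt.
have cE : ((left_vec (a t) (b t) z)^T *m A t) ord0 ord0 = F z - X t ord0 ord0.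
  by rewrite mulmx_strict_lower_col0 uX !mxE mulr1 mul1r.
rewrite /= cE in du.
have := is_derive_mulmx (is_derive_mulmx du (dM Jt)) dv ord0 ord0.
move=> h; apply: is_derive_eq h _; rewrite /pairing -/(M t).
move: (F z - _) => c.
move: (_^T) (right_vec _ _ _) (M t) (A t) (B t) => u v M' A' B'.
transitivity ((c *: (u *m M' *m v)) ord0 ord0); last by rewrite mxE.
congr (fun_of_matrix _ _ _).
rewrite mulmxBl mulmxBr !mulmxDl -!scalemxAl !mulNmx !mulmxA.
by rewrite addrA subrK subrK.
Qed.

Let pdiff_pairing z : 0 < z -> piecewise_diff J (fun s => pairing (a s) (b s) z).
Proof.
move=> z0; rewrite /pairing; under eq_fun do rewrite mxE.
apply: pdiff_sum => i; apply: pdiffM; last exact: pdiff_right_vec.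
under eq_fun do rewrite mxE.
by apply: pdiff_sum => k; apply: pdiffM; [exact: pdiff_left_vec|exact: pdiff_Mmx].
Qed.

Let pairing_eig_neq0 s t j : J s -> J t -> pairing (a t) (b t) (lambda s j) != 0.
Proof.
move=> Js Jt; rewrite /lambda (pencil_eig_cst Js Jt).
by apply: pairing_neq0; [exact: a_gt0|exact: b_gt0].
Qed.

(* The factor [X t ord0 ord0] of [derive_pairing] does not depend on j, hence
   cancels in ratios. *)
Lemma spectral_weight_ratio t j k : J 0 -> J t ->
  let w s j := spectral_weight (L s) (M s) j in
  w t k * (w 0 j * expR (- (t * F (lambda 0 j)))) =
  w t j * (w 0 k * expR (- (t * F (lambda 0 k)))).
Proof.
move=> J0 Jt w.
pose d j s := pairing (a s) (b s) (lambda 0 j).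
have wE x i : J x -> w x i = (d i x)^-1.
  move=> Jx; rewrite /w spectral_weightE; [|exact: a_gt0|exact: b_gt0].
  by rewrite /d /lambda (pencil_eig_cst J0 Jx).
have d0 i x : J x -> d i x != 0 by exact: pairing_eig_neq0.
pose e := F (lambda 0 k) - F (lambda 0 j).
(* The quotient of pairings has logarithmic derivative F(lambda_j) - F(lambda_k) = -e, which the
   exponential compensates. *)
pose r s := d j s * (d k s)^-1 * expR (s * e).
have rcst : r t = r 0.
  have [l0 _ _] := pencil_eigP (a_gt0 J0) (b_gt0 J0).
  have gd i : piecewise_diff J (d i) by apply: pdiff_pairing; exact: l0.
  have ge : piecewise_diff J (fun s => expR (s * e)).
    split=> [|x _].
      apply: continuous_subspaceT => x; apply: continuous_comp;
        last exact: continuous_expR.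
      by apply: continuousM; [exact: cvg_id|exact: cvg_cst].
    by apply: ex_derive.
  apply: (@interval_cst R J r _ _ _ t 0 Jt J0) => //.
    have [//] : piecewise_diff J r.
    by do ?apply: pdiffM => //; apply: pdiffV => //; exact: d0.
  move=> x Jx; have dk := d0 k x (interior_subset Jx).
  have dj' := derive_pairing j J0 Jx.
  have dk' := derive_pairing k J0 Jx.
  rewrite -/(d j x) -/(d k x) in dj' dk'.
  have de : is_derive x (1 : R) (fun s => expR (s * e)) (e * expR (x * e)).
    apply: is_derive_eq; rewrite /GRing.scale /=; ring.
  apply: is_derive_eq (is_deriveM (is_deriveM dj' (is_deriveV dk dk')) de) _.
  rewrite /GRing.scale /= /e !fctE; rewrite -/(d j x); field; exact: dk.
move: rcst; rewrite /r mul0r expR0 mulr1 !wE // => rcst.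
have -> : expR (- (t * F (lambda 0 j))) = expR (t * e) * expR (- (t * F (lambda 0 k))).
  by rewrite -expRD; congr expR; rewrite /e; ring.
have := (d0 j t Jt, d0 k t Jt, d0 j 0 J0, d0 k 0 J0).
case=> [[[djt dkt] dj0] dk0].
(* This is [rcst] solved for the exponential, so that the claim becomes an identity of rational
   functions in the pairings. *)
have -> : expR (t * e) = d j 0 * (d k 0)^-1 * (d k t / d j t).
  by rewrite -rcst; field; rewrite djt dkt.
by field; rewrite djt dkt dj0 dk0.
Qed.
End Flow.

Theorem theorem3p7 (R : realType) (n : nat) (F : R -> R) (J : set R)
    (a : R -> 'I_n.+1 -> R) (b : R -> 'I_n -> R)
    (hJ : is_interval J) (hJ0 : J 0)
    (hsol : toda_solution F J a b)
    (t : R) (ht : J t) (j : 'I_n.+1) :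
  let w s k := spectral_weight (Lmx (a s)) (Mmx (b s)) k in
  let lambda k := pencil_eig (Lmx (a 0)) (Mmx (b 0)) k in
  w t j = w 0 j * expR (- (t * F (lambda j)))
          / \sum_(k < n.+1) w 0 k * expR (- (t * F (lambda k))).
Proof.
move=> w lambda.
have [at0 bt0] : (forall i, 0 < a t i) /\ (forall k, 0 < b t k).
  by case: hsol => h _ _ _ _; exact: h.
have [a00 b00] : (forall i, 0 < a 0 i) /\ (forall k, 0 < b 0 k).
  by case: hsol => h _ _ _ _; exact: h.
set S := \sum_(k < n.+1) _.
(* The ratio identities are summed over [k], the weights at time [t] having sum 1. *)
have e : w 0 j * expR (- (t * F (lambda j))) = w t j * S.
  rewrite -[LHS]mul1r -(sum_spectral_weight at0 bt0) mulr_suml mulr_sumr.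
  by apply: eq_bigr => k _; exact: (spectral_weight_ratio hJ hsol).
(* Read off [e], whose left side is an inverse nonzero pairing times an exponential. *)
have S0 : S != 0.
  have : w 0 j * expR (- (t * F (lambda j))) != 0.
    rewrite mulf_eq0 negb_or (gt_eqF (expR_gt0 _)) andbT /w spectral_weightE //.
    by rewrite invr_eq0 pairing_neq0.
  by rewrite e mulf_eq0 negb_or => /andP[].
by rewrite e mulfK.
Qed.
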